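(* Let $A_1=P_1J_1P_1^{-1}$ with $J_1=\mathrm{diag}(-p_1,-q_1)$, $0<p_1<q_1$, and $A_2=P_2J_2P_2^{-1}$ with $J_2=\begin{pmatrix}\alpha_2&\beta_2\\-\beta_2&\alpha_2\end{pmatrix}$, $\alpha_2>0$, $\beta_2\neq0$; here $P_1,P_2$ are real invertible $2\times 2$ matrices chosen such that $M=P_2^{-1}P_1=\begin{pmatrix}a&b\\c&d\end{pmatrix}$ has determinant $1$. Given $\eta>0$, let $\tau_{2,1}(\eta)$ be the unique positive solution $t$ of $$\alpha_2\eta=\left(\frac{q_1+p_1}{2}\right)t-\sinh^{-1}\left(\sqrt{(a^2+c^2)(b^2+d^2)}\,\sinh\left(\frac{q_1-p_1}{2}\,t\right)\right).$$ Then the switched system $\dot x(t)=A_{\sigma(t)}x(t)$ is stable for all $\sigma\in\mathcal S[\tau_{2,1}(\eta),\eta]$ and asymptotically stable for all $\sigma\in\mathcal S'[\tau_{2,1}(\eta),\eta]$.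
   Context: Planar switched system: $\dot x(t)=A_{\sigma(t)}x(t)$, $x(t)\in\mathbb R^2$ continuous in $t\ge0$, with $A_1,A_2$ real $2\times2$ matrices. A switching signal $\sigma:[0,\infty)\to\{1,2\}$ is right-continuous and piecewise constant with infinitely many discontinuities $0<d_1<d_2<\cdots$, $d_k\to\infty$; set $d_0=0$. For a signal with $\sigma(0)=1$ put $t_k=d_{2k-1}-d_{2k-2}$ (times spent in $A_1$) and $s_k=d_{2k}-d_{2k-1}$ (times spent in $A_2$), $k\ge1$. For $\tau,\eta>0$, $\mathcal S[\tau,\eta]$ is the set of signals with $\sigma(0)=1$, $t_k\ge\tau$ and $s_k\le\eta$ for all $k\in\mathbb N$; $\mathcal S'[\tau,\eta]$ is the set of $\sigma\in\mathcal S[\tau,\eta]$ for which the sequence $(t_k,s_k)_{k\ge1}$ does not converge to $(\tau,\eta)$. For a given signal $\sigma$, the system is stable if for every $\varepsilon'>0$ there is $\delta>0$ such that $\|x(0)\|<\delta$ implies $\|x(t)\|<\varepsilon'$ for all $t>0$; it is asymptotically stable if it is stable and $\|x(t)\|\to0$ as $t\to\infty$ for every $x(0)\in\mathbb R^2$. Norms are Euclidean. *)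

(* Defs.v *)
From HB Require Import structures.
From mathcomp Require Import all_boot all_order all_algebra.
From mathcomp Require Import all_classical all_reals all_analysis.
From mathcomp Require Import ring lra.
Set Implicit Arguments.
Unset Strict Implicit.
Unset Printing Implicit Defensive.
Import Order.TTheory GRing.Theory Num.Theory.
Import numFieldNormedType.Exports.
Local Open Scope classical_set_scope.
Local Open Scope ring_scope.

Definition sinh {R : realType} (x : R) : R := (expR x - expR (- x)) / 2.

Definition arsinh {R : realType} (x : R) : R := ln (x + Num.sqrt (x ^+ 2 + 1)).

(* [arsinhK] and [sinhK] show that [arsinh] is the two-sided inverse of [sinh]. *)
Lemma arsinhK {R : realType} : cancel (@arsinh R) sinh.
Proof.
move=> x; rewrite /sinh /arsinh.
have s2 : Num.sqrt (x ^+ 2 + 1) ^+ 2 = x ^+ 2 + 1.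
  by rewrite sqr_sqrtr // addr_ge0 // sqr_ge0.
have : 0 <= Num.sqrt (x ^+ 2 + 1) := sqrtr_ge0 _.
move: (Num.sqrt _) s2 => s s2 s0.
have p : 0 < x + s by nra.
by rewrite expRN lnK ?posrE //; field: s2; rewrite ?gt_eqF.
Qed.

Lemma sinhK {R : realType} : cancel (@sinh R) arsinh.
Proof.
move=> x; rewrite /sinh /arsinh expRN.
have e0 := expR_gt0 x; have en : expR x != 0 by rewrite gt_eqF.
have -> : ((expR x - (expR x)^-1) / 2) ^+ 2 + 1
          = ((expR x + (expR x)^-1) / 2) ^+ 2 by field.
rewrite sqrtr_sqr ger0_norm; last by rewrite divr_ge0 // addr_ge0 ?invr_ge0 ltW.
have -> : (expR x - (expR x)^-1) / 2 + (expR x + (expR x)^-1) / 2 = expR x.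
  by field.
exact: expRK.
Qed.

Definition mx2 {R : realType} (a b c d : R) : 'M[R]_2 :=
  \matrix_(i < 2, j < 2)
    if i == 0 then (if j == 0 then a else b) else (if j == 0 then c else d).

(* Euclidean: the canonical norm [`| _ |] on matrices is the sup norm. *)
Definition enorm {R : realType} {n : nat} (x : 'cV[R]_n) : R :=
  Num.sqrt (\sum_(i < n) x i 0 ^+ 2).

Variant mode := mode1 | mode2.

(* A right-continuous piecewise constant signal on [0, +oo) whose set of
   discontinuities is {d_1 < d_2 < ...}, bundled with the sequence d (so
   [jump s k] is d_k and d_0 = 0). Values at negative times are irrelevant. *)
Record signal (R : realType) := Signal {
  mode_at :> R -> mode ;
  jump : nat -> R ;
  jump0 : jump 0%N = 0 ;
  jump_incr : forall k : nat, jump k < jump k.+1 ;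
  jump_dvg : jump k @[k --> \oo] --> +oo ;
  mode_cst : forall (k : nat) (t : R),
    jump k <= t < jump k.+1 -> mode_at t = mode_at (jump k) ;
  mode_jump : forall k : nat, mode_at (jump k.+1) <> mode_at (jump k)
}.

(* Indices start at 0: [dwell1 s k] is t_{k+1} and [dwell2 s k] is s_{k+1}. *)
Definition dwell1 {R : realType} (s : signal R) (k : nat) : R :=
  jump s (2 * k + 1) - jump s (2 * k).
Definition dwell2 {R : realType} (s : signal R) (k : nat) : R :=
  jump s (2 * k + 2) - jump s (2 * k + 1).

Definition signals {R : realType} (tau eta : R) : set (signal R) :=
  [set s : signal R | s 0 = mode1 /\
           forall k : nat, tau <= dwell1 s k /\ dwell2 s k <= eta].

Definition signals' {R : realType} (tau eta : R) : set (signal R) :=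
  [set s : signal R | signals tau eta s /\
           ~ ((dwell1 s k, dwell2 s k) @[k --> \oo] --> (tau, eta))].

Section SwitchedSystem.
Context {R : realType}.
Variables (A1 A2 : 'M[R]_2) (s : signal R).

Definition subsystem (m : mode) : 'M[R]_2 :=
  match m with mode1 => A1 | mode2 => A2 end.

(* The differential equation cannot be imposed at the discontinuities of the
   signal, where x has only one-sided derivatives. *)
Definition solution (x : R -> 'cV[R]_2) : Prop :=
  {within [set t : R | 0 <= t], continuous x} /\
  forall t : R, 0 < t -> (forall k : nat, t <> jump s k) ->
    is_derive t 1 x (subsystem (s t) *m x t).

Definition stable : Prop :=
  forall e : R, 0 < e -> exists2 delta : R, 0 < delta &
    forall x : R -> 'cV[R]_2, solution x -> enorm (x 0) < delta ->
      forall t : R, 0 < t -> enorm (x t) < e.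

Definition asymptotically_stable : Prop :=
  stable /\
  forall x : R -> 'cV[R]_2, solution x -> enorm (x t) @[t --> +oo] --> (0 : R).

End SwitchedSystem.

Definition is_tau21 {R : realType} (p1 q1 alpha2 a b c d eta t : R) : Prop :=
  0 < t /\
  alpha2 * eta = (q1 + p1) / 2 * t
    - arsinh (Num.sqrt ((a ^+ 2 + c ^+ 2) * (b ^+ 2 + d ^+ 2))
              * sinh ((q1 - p1) / 2 * t)).

(* Main.v *)
Require Import Defs.
From mathcomp Require Import all_boot all_order all_algebra.
From mathcomp Require Import all_classical all_reals all_analysis.
From mathcomp Require Import ring lra.
Set Implicit Arguments.
Unset Strict Implicit.
Unset Printing Implicit Defensive.
Import Order.TTheory GRing.Theory Num.Theory.
Import numFieldNormedType.Exports.
Local Open Scope classical_set_scope.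
Local Open Scope ring_scope.

(** Work in the coordinates [y = P2^-1 x], in which the second mode is a
    similarity: during a time [s] it multiplies the Euclidean norm by exactly
    [exp (alpha2 s)].  In the same coordinates the first mode has the flow
    [M diag(exp(-p t), exp(-q t)) M^-1], that is [exp(-(p+q)t/2)] times a
    matrix [S] of determinant 1.  The singular values of [S] are [sigma] and
    [1/sigma], and the Frobenius norm of [S] gives
    [sigma - 1/sigma = 2 m sinh((q-p)t/2)] with
    [m = sqrt((a^2+c^2)(b^2+d^2))].  Hence the operator norm of the flow is
    [exp (- phi t)], where
    [phi t = (q+p)/2 t - arsinh (m sinh ((q-p)/2 t))]
    is the right-hand side of the equation for [tau] ([mode1_arc]).

    Since [det M = 1], Lagrange's identity gives [m >= 1], so
    [u |-> arsinh (m sinh u)] is concave on [u >= 0]; thus [phi] is convex with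
    [phi 0 = 0], and [phi t / t] is nondecreasing ([decay_chord]).  Together
    with [phi t >= p t - ln m] this shows that every positive level is attained
    exactly once on [t > 0], and that [phi] increases strictly from there on.
    So for [phi tau = alpha2 eta], [t_k >= tau] and [s_k <= eta], one cycle
    multiplies the norm by at most [exp (alpha2 s_k - phi t_k) <= 1].  Inside a
    cycle the norm overshoots by a bounded factor only, which gives stability.

    If [(t_k, s_k)] does not tend to [(tau, eta)], then some [e > 0] is exceeded
    by the deviation of infinitely many cycles.  By strict monotonicity of
    [phi], each of them multiplies the norm by at most a fixed [rho < 1], while
    the other cycles do not increase it; so the norm tends to 0. *)

(** * Hyperbolic sine composed with a dilation *)

Section HyperbolicSine.
Context {R : realType}.
Implicit Types m x y u v w : R.

Lemma sinh0 : sinh 0 = 0 :> R.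
Proof. by rewrite /sinh oppr0 subrr mul0r. Qed.

Lemma arsinh0 : arsinh 0 = 0 :> R.
Proof. by rewrite -[in LHS]sinh0 sinhK. Qed.

Lemma ltr_sinh : {homo @sinh R : x y / x < y}.
Proof.
move=> x y xy; rewrite /sinh ltr_pM2r ?invr_gt0 ?ltr0n //.
by apply: ltrB; rewrite ltr_expR // ltrN2.
Qed.

Lemma ler_sinh : {mono @sinh R : x y / x <= y}.
Proof. exact: le_mono ltr_sinh. Qed.

Lemma ler_arsinh : {mono @arsinh R : x y / x <= y}.
Proof. by move=> x y; rewrite -ler_sinh !arsinhK. Qed.

Lemma expR_sub_expRN x : expR x - expR (- x) = 2 * sinh x.
Proof. by rewrite /sinh; field. Qed.

Lemma is_derive_sinh x : is_derive x 1 sinh ((expR x + expR (- x)) / 2).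
Proof.
rewrite (_ : sinh = 2^-1 \*: (expR - (expR \o -%R))); last first.
  by apply/funext => y; rewrite /sinh !fctE /GRing.scale /= mulrC.
by apply: is_derive_eq; rewrite /GRing.scale /=; field.
Qed.

Lemma is_derive_arsinh x : is_derive x 1 arsinh (Num.sqrt (x ^+ 2 + 1))^-1.
Proof.
have x1 : 0 < x ^+ 2 + 1 by rewrite ltr_wpDl // sqr_ge0.
have s0 : 0 < Num.sqrt (x ^+ 2 + 1) by rewrite sqrtr_gt0.
have s2 : Num.sqrt (x ^+ 2 + 1) ^+ 2 = x ^+ 2 + 1 by rewrite sqr_sqrtr // ltW.
have p0 : 0 < x + Num.sqrt (x ^+ 2 + 1) by nra.
have dq : is_derive x 1 (fun y : R => y ^+ 2 + 1) (2 * x).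
  rewrite (_ : (fun _ => _) = id ^+ 2 + cst 1 :> (R -> R)) //.
  by apply: is_derive_eq; rewrite /GRing.scale /= expr1; ring.
have ds := @is_derive1_comp R Num.sqrt (fun y => y ^+ 2 + 1) x _ _
  (is_derive1_sqrt x1) dq.
have di := is_deriveD (is_derive_id x 1) ds.
have dl := @is_derive1_comp R (@ln R) _ x _ _ (is_derive1_ln p0) di.
apply: (is_derive_eq dl); field; rewrite !gt_eqF //.
Qed.

Lemma is_derive_arsinh_sinh m u :
  is_derive u 1 (fun v => arsinh (m * sinh v))
    (m * ((expR u + expR (- u)) / 2) / Num.sqrt ((m * sinh u) ^+ 2 + 1)).
Proof.
have ds : is_derive u 1 (fun v => m * sinh v) (m * ((expR u + expR (- u)) / 2)).
  exact: (is_deriveZ m (is_derive_sinh u)).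
apply: (is_derive_eq (is_derive1_comp (is_derive_arsinh _) ds)).
by rewrite mulrC.
Qed.

(** The slope is nonincreasing because its square is
    [1 + (m^2 - 1) / (1 + m^2 sinh^2 u)]. *)
Lemma arsinh_sinh_slope_le m u v : 1 <= m -> 0 <= u -> u <= v ->
  m * ((expR v + expR (- v)) / 2) / Num.sqrt ((m * sinh v) ^+ 2 + 1) <=
  m * ((expR u + expR (- u)) / 2) / Num.sqrt ((m * sinh u) ^+ 2 + 1).
Proof.
move=> m1 u0 uv.
have pos w : 0 < (m * sinh w) ^+ 2 + 1 by rewrite ltr_wpDl // sqr_ge0.
have ch w : ((expR w + expR (- w)) / 2) ^+ 2 = sinh w ^+ 2 + 1.
  have := gt_eqF (expR_gt0 w) => e0.
  by rewrite /sinh expRN; field; rewrite e0.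
have cp w : 0 <= m * ((expR w + expR (- w)) / 2).
  by rewrite mulr_ge0 ?divr_ge0 ?addr_ge0 ?expR_ge0 //; lra.
have su : 0 <= sinh u by rewrite -sinh0 ler_sinh.
have suv : sinh u <= sinh v by rewrite ler_sinh.
move: (ch u) (cp u) (ch v) (cp v).
move: ((expR u + _) / 2) ((expR v + _) / 2) => cu cv cu2 cu0 cv2 cv0.
rewrite -ler_sqr ?nnegrE ?divr_ge0 ?sqrtr_ge0 // !expr_div_n.
rewrite !sqr_sqrtr ?(ltW (pos _)) //.
rewrite [(m * cv) ^+ 2]exprMn [(m * cu) ^+ 2]exprMn cu2 cv2.
rewrite ler_pdivrMr // [leRHS]mulrAC ler_pdivlMr //.
rewrite -mulrA -[leRHS]mulrA ler_pM2l ?exprn_gt0 //; last by lra.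
rewrite [(m * sinh u) ^+ 2]exprMn [(m * sinh v) ^+ 2]exprMn.
have sq : sinh u ^+ 2 <= sinh v ^+ 2.
  by rewrite ler_sqr ?nnegrE //; exact: le_trans suv.
have m2 : 1 <= m ^+ 2 by rewrite exprn_ege1.
have : 0 <= (m ^+ 2 - 1) * (sinh v ^+ 2 - sinh u ^+ 2).
  by rewrite mulr_ge0 ?subr_ge0.
by move=> ?; lra.
Qed.

(** A concave function vanishing at 0 has nonincreasing ratio to the identity;
    the mean value theorem is applied on [0, u] and on [u, v]. *)
Lemma arsinh_sinh_chord m u v : 1 <= m -> 0 < u -> u <= v ->
  u * arsinh (m * sinh v) <= v * arsinh (m * sinh u).
Proof.
move=> m1 u0 uv.
have cont a b : {within `[a, b], continuous (fun w => arsinh (m * sinh w))}.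
  apply: derivable_within_continuous => w _.
  by have [] := is_derive_arsinh_sinh m w.
have := MVT_segment (ltW u0) (fun w _ => is_derive_arsinh_sinh m w) (cont 0 u).
case=> x; rewrite in_itv /= => /andP[x0 xu]; rewrite sinh0 mulr0 arsinh0 !subr0.
move=> hu.
have := MVT_segment uv (fun w _ => is_derive_arsinh_sinh m w) (cont u v).
case=> y; rewrite in_itv /= => /andP[uy yv] hv.
have := arsinh_sinh_slope_le m1 x0 (le_trans xu uy).
move: hu hv; set s := (X in _ = X * u); set s' := (X in _ = X * (v - u)).
move=> hu hv ss.
have -> : arsinh (m * sinh v) = s * u + s' * (v - u) by lra.
rewrite hu; suff : 0 <= (s - s') * (u * (v - u)) by nra.
by rewrite mulr_ge0 ?subr_ge0 // mulr_ge0 ?subr_ge0 // ltW.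
Qed.

Lemma arsinh_sinh_ge m u : 1 <= m -> 0 <= u -> u <= arsinh (m * sinh u).
Proof.
move=> m1 u0; rewrite -[leLHS]sinhK ler_arsinh ler_peMl //.
by rewrite -sinh0 ler_sinh.
Qed.

(** For [m >= 1], [sinh (u + ln m) = (m e^u - e^-u / m) / 2 >= m sinh u]. *)
Lemma arsinh_sinh_le m u : 1 <= m -> arsinh (m * sinh u) <= ln m + u.
Proof.
move=> m1; have m0 : 0 < m by lra.
rewrite -[leRHS]sinhK ler_arsinh /sinh opprD !expRD [expR (- ln m)]expRN.
rewrite lnK ?posrE //.
rewrite mulrA ler_pM2r ?invr_gt0 ?ltr0n // mulrBr lerD2l lerN2.
by rewrite ler_pM2r ?expR_gt0 // (le_trans _ m1) // invf_le1.
Qed.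

End HyperbolicSine.

(** * The decay exponent of the stable mode *)

Section DecayExponent.
Context {R : realType}.
Variables m p q : R.
Hypotheses (m1 : 1 <= m) (p0 : 0 < p) (pq : p < q).

(** Minus the logarithm of the operator norm at time [t] of a flow with
    eigenvalues [exp (- p t)] and [exp (- q t)], where [m] is the product of the
    norms of two eigenvectors spanning a parallelogram of area 1. *)
Definition decay (t : R) : R :=
  (q + p) / 2 * t - arsinh (m * sinh ((q - p) / 2 * t)).

Lemma decay0 : decay 0 = 0.
Proof. by rewrite /decay !mulr0 sinh0 mulr0 arsinh0 subrr. Qed.

(** The form in which convexity of [decay] is used: it gives both the
    monotonicity beyond a positive value and the uniqueness of [tau]. *)
Lemma decay_chord (t t' : R) : 0 < t -> t <= t' -> t' * decay t <= t * decay t'.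
Proof.
move=> t0 tt'; have r0 : 0 < (q - p) / 2 by rewrite divr_gt0 ?subr_gt0.
have : (q - p) / 2 * t <= (q - p) / 2 * t' by rewrite ler_pM2l.
move=> /(arsinh_sinh_chord m1 (mulr_gt0 r0 t0)); rewrite /decay.
move: (arsinh _) (arsinh _) => h' h; rewrite -!mulrA !(mulrA (q - p)).
by rewrite ler_pM2l // => ?; lra.
Qed.

Lemma decay_le (t t' : R) :
  0 < t -> 0 <= decay t -> t <= t' -> decay t <= decay t'.
Proof.
move=> t0 dt tt'; rewrite -(ler_pM2l t0).
by apply: le_trans (decay_chord t0 tt'); rewrite ler_wpM2r.
Qed.

Lemma decay_lt (t t' : R) :
  0 < t -> 0 < decay t -> t < t' -> decay t < decay t'.
Proof.
move=> t0 dt tt'; rewrite -(ltr_pM2l t0).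
by apply: lt_le_trans (decay_chord t0 (ltW tt')); rewrite ltr_pM2r.
Qed.

Lemma decay_ge (t : R) : p * t - ln m <= decay t.
Proof.
by rewrite /decay; have := @arsinh_sinh_le _ m ((q - p) / 2 * t) m1; lra.
Qed.

Lemma continuous_decay : continuous decay.
Proof.
move=> t; apply: cvgB; first by apply: cvgM; [exact: cvg_cst|exact: cvg_id].
apply: (@continuous_comp _ _ _ ( *%R ((q - p) / 2))
  (fun u => arsinh (m * sinh u))).
  by apply: cvgM; [exact: cvg_cst|exact: cvg_id].
apply: differentiable_continuous; apply/derivable1_diffP.
by have [] := is_derive_arsinh_sinh m ((q - p) / 2 * t).
Qed.

Lemma decay_unique_level (y : R) : 0 < y -> exists! t, 0 < t /\ y = decay t.
Proof.
move=> y0; pose T := (y + ln m) / p.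
have lnm : 0 <= ln m by rewrite ln_ge0.
have T0 : 0 <= T by rewrite divr_ge0 ?addr_ge0 // ltW.
have yT : y <= decay T.
  apply: le_trans (decay_ge T).
  by rewrite /T mulrCA divff ?mulr1 ?addrK // gt_eqF.
have := @IVT R decay 0 T y T0 (continuous_subspaceT continuous_decay).
rewrite decay0 ge_min le_max ltW //= yT orbT => /(_ isT)[t].
rewrite in_itv /= => /andP[t0 _] ty.
have {}t0 : 0 < t.
  rewrite lt_neqAle t0 andbT; apply/eqP => t00.
  by move: y0; rewrite -ty -t00 decay0 ltxx.
exists t; split=> // t' [t'0 yt'].
have [lt|lt|//] := ltgtP t t'.
  have := decay_lt t0 _ lt; rewrite ty => /(_ y0); by rewrite -yt' ltxx.
have := decay_lt t'0 _ lt; rewrite -yt' => /(_ y0); by rewrite ty ltxx.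
Qed.

End DecayExponent.

(** * Linear differential equations in the plane *)

Section Plane.
Context {R : realType}.
Implicit Types (Q A : 'M[R]_2) (v : 'cV[R]_2) (x : R -> 'cV[R]_2).

Lemma sum_I2 (F : 'I_2 -> R) : \sum_i F i = F 0 + F 1.
Proof. by rewrite big_ord_recl big_ord1; congr (_ + F _); exact: val_inj. Qed.

Lemma mulmx_col2 Q v i : (Q *m v) i 0 = Q i 0 * v 0 0 + Q i 1 * v 1 0.
Proof. by rewrite mxE sum_I2. Qed.

Lemma mulmx_mx2 (a b c d : R) v :
  (mx2 a b c d *m v) 0 0 = a * v 0 0 + b * v 1 0 /\
  (mx2 a b c d *m v) 1 0 = c * v 0 0 + d * v 1 0.
Proof. by rewrite !mulmx_col2 /mx2 !mxE. Qed.

Lemma det_mx2 (a b c d : R) : \det (mx2 a b c d) = a * d - b * c.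
Proof.
rewrite (expand_det_row _ 0) sum_I2 /cofactor !det_mx11 /mx2 !mxE /=.
by rewrite expr0 expr1; ring.
Qed.

Lemma enorm_ge0 v : 0 <= enorm v.
Proof. exact: sqrtr_ge0. Qed.

Lemma sqr_enorm v : enorm v ^+ 2 = v 0 0 ^+ 2 + v 1 0 ^+ 2.
Proof. by rewrite sqr_sqrtr sum_I2 // addr_ge0 ?sqr_ge0. Qed.

Lemma enorm_mulmx_le Q :
  exists2 K, 0 < K & forall v, enorm (Q *m v) <= K * enorm v.
Proof.
pose S := (Q 0 0 ^+ 2 + Q 0 1 ^+ 2) + (Q 1 0 ^+ 2 + Q 1 1 ^+ 2).
have S0 : 0 <= S by rewrite !addr_ge0 ?sqr_ge0.
have K0 : 0 < 1 + S by lra.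
exists (1 + S) => // v.
rewrite -ler_sqr ?nnegrE ?mulr_ge0 ?enorm_ge0 ?(ltW K0) //.
rewrite exprMn !sqr_enorm !mulmx_col2.
have cs (a b y z : R) :
    (a * y + b * z) ^+ 2 <= (a ^+ 2 + b ^+ 2) * (y ^+ 2 + z ^+ 2).
  by have := sqr_ge0 (a * z - b * y); lra.
apply: (le_trans (lerD (cs _ _ _ _) (cs _ _ _ _))).
rewrite -mulrDl ler_wpM2r ?addr_ge0 ?sqr_ge0 // -/S.
by have := sqr_ge0 S; lra.
Qed.

Lemma is_derive_mulmx_coord Q A x (t : R) (i : 'I_2) :
  is_derive t 1 x (A *m x t) ->
  is_derive t 1 (fun u => (Q *m x u) i 0) ((Q *m A *m x t) i 0).
Proof.
case=> /[dup] dx /derivable_mxP dxi; rewrite (derive_mx dx) => Ax.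
have dxj j : is_derive t 1 (fun u => x u j 0) ((A *m x t) j 0).
  by apply: DeriveDef => //; rewrite -Ax mxE.
have -> : (fun u => (Q *m x u) i 0) =
    (Q i 0 \*: (fun u => x u 0 0)) + (Q i 1 \*: (fun u => x u 1 0)).
  by apply/funext => u; rewrite mulmx_col2.
rewrite -mulmxA mulmx_col2.
by apply: is_deriveD; apply: is_deriveZ.
Qed.

Lemma continuous_mulmx_coord (D : set R) Q x (i : 'I_2) :
  {within D, continuous x} -> {within D, continuous (fun u => (Q *m x u) i 0)}.
Proof.
move=> cx.
have cxj j : {within D, continuous (fun u => x u j 0)}.
  move=> u.
  apply: (@continuous_comp (subspace D) _ _ x (fun v : 'cV[R]_2 => v j 0)).
    exact: cx.
  exact: coord_continuous.
have -> : (fun u => (Q *m x u) i 0) =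
    (fun u => Q i 0 * x u 0 0 + Q i 1 * x u 1 0).
  by apply/funext => u; rewrite mulmx_col2.
by move=> u; apply: cvgD; apply: cvgM;
  [exact: cvg_cst|exact: (cxj 0 u)|exact: cvg_cst|exact: (cxj 1 u)].
Qed.

(** The function [t |-> f t * exp (- k (t - l))] has zero derivative.  The
    equation is only required inside the interval, where a trajectory is
    differentiable between two switching times. *)
Lemma exponential_solution (f : R -> R) (k l r : R) :
  {within `[l, r], continuous f} ->
  (forall t, l < t < r -> is_derive t 1 f (k * f t)) ->
  forall t, l <= t <= r -> f t = expR (k * (t - l)) * f l.
Proof.
move=> cf df t /andP[lt tr].
pose e (u : R) : R := expR (- (k * (u - l))).
have de (u : R) : is_derive u 1 e (- k * e u).
  have dl : is_derive u 1 (fun w : R => - (k * (w - l))) (- k).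
    rewrite (_ : (fun _ => _) = - (k \*: (id - cst l))) //.
    by apply: is_derive_eq; rewrite subr0 /GRing.scale /= mulr1.
  apply: is_derive_eq (is_derive1_comp (is_derive_expR _) dl) _.
  by rewrite mulrC.
have deriv (u : R) : u \in `]l, t[%R -> is_derive u 1 (f * e) 0.
  rewrite in_itv /= => /andP[lu ut].
  have dfu : is_derive u 1 f (k * f u).
    by apply: df; rewrite lu (lt_le_trans ut).
  apply: is_derive_eq; rewrite /GRing.scale /=; ring.
have cont : {within `[l, t], continuous (f * e)}.
  have sub : `[l, t] `<=` `[l, r].
    by apply: subset_itvl; rewrite bnd_simp.
  move=> u; apply: cvgM; first exact: (continuous_subspaceW sub cf).
  apply: continuous_subspaceT => w.
  by apply: differentiable_continuous; apply/derivable1_diffP; case: (de w).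
have [c _] := MVT_segment lt deriv cont.
rewrite mul0r => /eqP; rewrite subr_eq0 => /eqP.
rewrite !fctE /e subrr mulr0 oppr0 expR0 mulr1 => <-.
by rewrite mulrCA -expRD subrr expR0 mulr1.
Qed.

End Plane.

(** * The norm of a conjugated diagonal flow *)

Section DiagonalFlowNorm.
Context {R : realType}.
Implicit Types a b c d s E m x y : R.

Lemma psd_form A B C x y : 0 <= A -> 0 <= C -> A * C = B ^+ 2 ->
  0 <= A * x ^+ 2 + 2 * B * (x * y) + C * y ^+ 2 :> R.
Proof.
rewrite le0r => /predU1P[->|A0] C0 AC.
  have -> : B = 0 by apply/eqP; rewrite -sqrf_eq0 -AC mul0r.
  by rewrite mul0r mulr0 mul0r !add0r mulr_ge0 ?sqr_ge0.
rewrite -(pmulr_rge0 _ A0).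
have -> : A * (A * x ^+ 2 + 2 * B * (x * y) + C * y ^+ 2) =
    (A * x + B * y) ^+ 2 + (A * C - B ^+ 2) * y ^+ 2 by ring.
by rewrite AC subrr mul0r addr0 sqr_ge0.
Qed.

Lemma lagrange_det1 a b c d : a * d - b * c = 1 ->
  (a ^+ 2 + c ^+ 2) * (b ^+ 2 + d ^+ 2) = (a * b + c * d) ^+ 2 + 1.
Proof.
move=> det; have -> : 1 = (a * d - b * c) ^+ 2 by rewrite det expr1n.
by ring.
Qed.

(** The operator norm of [M diag(E, 1/E) M^-1] for [det M = 1].  The hypothesis
    on [s] says that [s] is its largest singular value.  The difference of the
    two sides is a quadratic form in [(x, y)]; its diagonal coefficients are
    nonnegative and its discriminant vanishes, because the largest singular
    value is attained. *)
Lemma diagonal_flow_norm a b c d s E x y :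
  let n2 := (a ^+ 2 + c ^+ 2) * (b ^+ 2 + d ^+ 2) in
  a * d - b * c = 1 -> 1 <= E -> E <= s ->
  (s - s^-1) ^+ 2 = n2 * (E - E^-1) ^+ 2 ->
  (a * (E * x) + b * (E^-1 * y)) ^+ 2 + (c * (E * x) + d * (E^-1 * y)) ^+ 2 <=
  s ^+ 2 * ((a * x + b * y) ^+ 2 + (c * x + d * y) ^+ 2).
Proof.
move=> n2 det E1 Es sE.
have E0 : 0 < E by lra.
have s0 : 0 < s by lra.
have En : E != 0 by rewrite gt_eqF.
have sn : s != 0 by rewrite gt_eqF.
have E2 : E ^+ 2 <= s ^+ 2 by rewrite ler_sqr ?nnegrE //; lra.
have Ei2 : E^-1 ^+ 2 <= s ^+ 2.
  rewrite ler_sqr ?nnegrE ?invr_ge0 ?(ltW E0) ?(ltW s0) //.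
  by rewrite (le_trans _ (le_trans E1 Es)) // invf_le1.
rewrite -subr_ge0.
pose A := (a ^+ 2 + c ^+ 2) * (s ^+ 2 - E ^+ 2).
pose B := (a * b + c * d) * (s ^+ 2 - 1).
pose C := (b ^+ 2 + d ^+ 2) * (s ^+ 2 - E^-1 ^+ 2).
have := @psd_form A B C x y.
have -> : A * x ^+ 2 + 2 * B * (x * y) + C * y ^+ 2 =
  s ^+ 2 * ((a * x + b * y) ^+ 2 + (c * x + d * y) ^+ 2) -
  ((a * (E * x) + b * (E^-1 * y)) ^+ 2 + (c * (E * x) + d * (E^-1 * y)) ^+ 2).
  by rewrite /A /B /C; field.
apply.
- by rewrite mulr_ge0 ?subr_ge0 // addr_ge0 ?sqr_ge0.
- by rewrite mulr_ge0 ?subr_ge0 // addr_ge0 ?sqr_ge0.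
apply/eqP; rewrite -subr_eq0; apply/eqP.
have ab : (a * b + c * d) ^+ 2 = n2 - 1 by rewrite /n2 lagrange_det1 // addrK.
transitivity (s ^+ 2 * ((s - s^-1) ^+ 2 - n2 * (E - E^-1) ^+ 2)).
  rewrite /A /B /C exprMn ab.
  have -> : (a ^+ 2 + c ^+ 2) * (s ^+ 2 - E ^+ 2) *
      ((b ^+ 2 + d ^+ 2) * (s ^+ 2 - E^-1 ^+ 2)) =
      n2 * ((s ^+ 2 - E ^+ 2) * (s ^+ 2 - E^-1 ^+ 2)) by rewrite /n2; ring.
  by move: n2 {ab sE A B C} => n2; field; rewrite En.
by rewrite sE subrr mulr0.
Qed.

End DiagonalFlowNorm.

(** * Switching signals *)

Section Signals.
Context {R : realType}.
Implicit Types (s : signal R) (k : nat) (t : R).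

Lemma jump_lt s : {homo jump s : i j / (i < j)%N >-> i < j}.
Proof. by apply: homo_ltn; [exact: lt_trans|exact: jump_incr]. Qed.

Lemma jump_le s : {mono jump s : i j / (i <= j)%N >-> i <= j}.
Proof. exact: (le_mono (@jump_lt s)). Qed.

Lemma jump_ge0 s k : 0 <= jump s k.
Proof. by rewrite -(jump0 s) jump_le. Qed.

Lemma mode_at_jumps s k : s 0 = mode1 ->
  s (jump s (2 * k)) = mode1 /\ s (jump s (2 * k + 1)) = mode2.
Proof.
move=> s0; have two i : s (jump s i) = mode1 -> s (jump s i.+1) = mode2.
  by move=> si; have := @mode_jump _ s i; rewrite si; case: (s _).
have one i : s (jump s i) = mode2 -> s (jump s i.+1) = mode1.
  by move=> si; have := @mode_jump _ s i; rewrite si; case: (s _).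
elim: k => [|k [_ IH]]; rewrite addn1.
  by rewrite muln0; split; [rewrite jump0|apply: two; rewrite jump0].
rewrite addn1 in IH; rewrite mulnS add2n.
by split; [exact: one|exact: two (one _ IH)].
Qed.

Lemma arc_no_jump s k t : jump s k < t < jump s k.+1 ->
  s t = s (jump s k) /\ forall j, t <> jump s j.
Proof.
move=> /andP[kt tk]; split=> [|j tj]; first by apply: mode_cst; rewrite ltW.
rewrite tj !ltNge !jump_le -!ltnNge ltnS in kt tk.
by have := leq_trans kt tk; rewrite ltnn.
Qed.

Lemma cycle_of_time s t : 0 <= t ->
  exists k, jump s (2 * k) <= t <= jump s (2 * k + 2).
Proof.
move=> t0.
have exk : exists k, t <= jump s (2 * k + 2).
  have /cvgryPge/(_ t)[N _ tN] := @jump_dvg _ s.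
  by exists N; apply: tN => /=; rewrite mul2n -addnn -addnA leq_addr.
case: (ex_minnP exk) => k tk kmin; exists k; rewrite tk andbT.
case: k tk kmin => [|k] _ kmin; first by rewrite muln0 jump0.
rewrite leNgt; apply/negP => lt.
have /kmin : t <= jump s (2 * k + 2) by rewrite addnC -mulnS ltW.
by rewrite ltnn.
Qed.

Lemma deviation_of_not_cvg (u v : nat -> R) (x y : R) :
  ~ ((u k, v k) @[k --> \oo] --> (x, y)) ->
  exists2 e : R, 0 < e &
    forall N, exists2 k, (N <= k)%N & e <= `|x - u k| \/ e <= `|y - v k|.
Proof.
move=> ncv; apply: contrapT => nex; apply: ncv.
have near e : 0 < e ->
    exists N, forall k, (N <= k)%N -> `|x - u k| < e /\ `|y - v k| < e.
  move=> e0; apply: contrapT => nN; apply: nex; exists e => // N.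
  apply: contrapT => nk; apply: nN; exists N => k Nk.
  by split; rewrite ltNge; apply/negP => ?; apply: nk; exists k; auto.
apply: (@cvg_pair _ _ _ \oo (nbhs x) (nbhs y) _ _ _ u v);
  apply/cvgrPdist_lt => e /near[N HN];
    by exists N => // k /= /HN[].
Qed.

(** The contracting steps need not be regularly spaced: since [V] never grows,
    it is enough to wait for the next one, [n] times in a row. *)
Lemma frequent_contraction_small (V : nat -> R) (rho : R) :
  0 <= rho -> rho < 1 -> (forall k, 0 <= V k) -> (forall k, V k.+1 <= V k) ->
  (forall N, exists2 k, (N <= k)%N & V k.+1 <= rho * V k) ->
  forall e, 0 < e -> exists k, V k < e.
Proof.
move=> r0 r1 V0 Vd Vr e e0.
have Vmono i j : (i <= j)%N -> V j <= V i.
  apply: (@homo_leq _ V (fun x y => y <= x)) => // y z w zy wz.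
  exact: le_trans wz zy.
have geo n : exists k, V k <= rho ^+ n * V 0%N.
  elim: n => [|n [N VN]]; first by exists 0%N; rewrite expr0 mul1r.
  have [k Nk Vk] := Vr N; exists k.+1; apply: (le_trans Vk).
  by rewrite exprS -mulrA ler_wpM2l // (le_trans (Vmono _ _ Nk)).
have V1 : 0 < V 0%N + 1 by rewrite ltr_wpDl.
have rn : `|rho| < 1 by rewrite ger0_norm.
have /cvgrPdist_lt/(_ (e / (V 0%N + 1))) := cvg_expr rn.
rewrite divr_gt0 // => /(_ isT)[n _ /(_ n (leqnn n))] /=.
rewrite sub0r normrN ger0_norm ?exprn_ge0 // ltr_pdivlMr // => rne.
have [k Vk] := geo n; exists k; apply: le_lt_trans rne.
by apply: (le_trans Vk); rewrite ler_wpM2l ?exprn_ge0 // lerDl.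
Qed.

End Signals.

(** * Growth of the norm along a trajectory *)

Section SwitchedFlow.
Context {R : realType}.
Variables (A1 A2 P1 P2 : 'M[R]_2) (p q alpha beta a b c d : R).
Hypotheses (p0 : 0 < p) (pq : p < q) (alpha0 : 0 < alpha).
Hypotheses (P1u : P1 \in unitmx) (P2u : P2 \in unitmx).
Hypothesis A1E : A1 = P1 *m mx2 (- p) 0 0 (- q) *m invmx P1.
Hypothesis A2E : A2 = P2 *m mx2 alpha beta (- beta) alpha *m invmx P2.
Hypothesis ME : invmx P2 *m P1 = mx2 a b c d.
Hypothesis detM : a * d - b * c = 1.

Let m : R := Num.sqrt ((a ^+ 2 + c ^+ 2) * (b ^+ 2 + d ^+ 2)).
Let phi := decay m p q.

(** Lagrange's identity: [m^2 = (a b + c d)^2 + (det M)^2].  Thus [m] measures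
    how far the eigenvectors of the first mode are from being orthogonal in the
    coordinates where the second mode is a similarity. *)
Lemma aspect_ge1 : 1 <= m.
Proof.
by rewrite -[leLHS]sqrtr1 ler_sqrt lagrange_det1 // ?lerDr ?addr_ge0 ?sqr_ge0.
Qed.

Lemma sqr_aspect : m ^+ 2 = (a ^+ 2 + c ^+ 2) * (b ^+ 2 + d ^+ 2).
Proof. by rewrite sqr_sqrtr // mulr_ge0 // addr_ge0 ?sqr_ge0. Qed.

Section Arcs.
Variable x : R -> 'cV[R]_2.
Hypothesis cx : {within [set t : R | 0 <= t], continuous x}.

Let n (t : R) : R := enorm (invmx P2 *m x t).

Let cont_coord (Q : 'M[R]_2) (i : 'I_2) (l r : R) : 0 <= l ->
  {within `[l, r], continuous (fun t => (Q *m x t) i 0)}.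
Proof.
move=> l0; apply: (@continuous_subspaceW _ _ _ [set t : R | 0 <= t]).
  by move=> t /=; rewrite in_itv /= => /andP[lt _]; exact: le_trans lt.
exact: continuous_mulmx_coord.
Qed.

(** The coordinates along the eigenvectors decay as [exp (- p t)] and
    [exp (- q t)]; factoring out their geometric mean leaves a flow of
    determinant 1, with [E = exp ((q - p) t / 2)]. *)
Lemma mode1_arc (l r : R) : 0 <= l ->
  (forall t : R, l < t < r -> is_derive t 1 x (A1 *m x t)) ->
  forall t, l <= t <= r -> n t <= expR (- phi (t - l)) * n l.
Proof.
move=> l0 dx t ltr; set dt := t - l.
have dt0 : 0 <= dt by rewrite subr_ge0; case/andP: ltr.
have dz i (u : R) : l < u < r -> is_derive u 1 (fun w => (invmx P1 *m x w) i 0)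
    ((mx2 (- p) 0 0 (- q) *m (invmx P1 *m x u)) i 0).
  move=> /dx /(is_derive_mulmx_coord (invmx P1) i).
  by rewrite A1E !mulmxA mulVmx // mul1mx.
have z0 : (invmx P1 *m x t) 0 0 = expR (- p * dt) * (invmx P1 *m x l) 0 0.
  apply: (exponential_solution (r := r)
    (f := fun w => (invmx P1 *m x w) 0 0)) => //; first exact: cont_coord.
  move=> u /(dz 0) /is_derive_eq; apply.
  by rewrite (mulmx_mx2 _ _ _ _ _).1 mul0r addr0.
have z1 : (invmx P1 *m x t) 1 0 = expR (- q * dt) * (invmx P1 *m x l) 1 0.
  apply: (exponential_solution (r := r)
    (f := fun w => (invmx P1 *m x w) 1 0)) => //; first exact: cont_coord.
  move=> u /(dz 1) /is_derive_eq; apply.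
  by rewrite (mulmx_mx2 _ _ _ _ _).2 mul0r add0r.
have yE u : invmx P2 *m x u = mx2 a b c d *m (invmx P1 *m x u).
  by rewrite -ME -mulmxA mulKVmx.
rewrite -ler_sqr ?nnegrE ?mulr_ge0 ?expR_ge0 ?enorm_ge0 //.
rewrite exprMn !sqr_enorm !yE !(mulmx_mx2 _ _ _ _ _).1 !(mulmx_mx2 _ _ _ _ _).2.
rewrite z0 z1; move: (_ 0 0) (_ 1 0) => y0 y1.
pose u := (q - p) / 2 * dt; pose E := expR u.
pose g := expR (- ((q + p) / 2 * dt)); pose s := expR (arsinh (m * sinh u)).
have -> : expR (- p * dt) = g * E by rewrite -expRD /u; congr expR; field.
have -> : expR (- q * dt) = g * E^-1.
  by rewrite -expRN -expRD /u; congr expR; field.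
have -> : expR (- phi dt) = g * s by rewrite -expRD opprB addrC.
have u0 : 0 <= u by rewrite mulr_ge0 // divr_ge0 // subr_ge0 ltW.
have E1 : 1 <= E by rewrite -expR0 ler_expR.
have Es : E <= s by rewrite ler_expR arsinh_sinh_ge // aspect_ge1.
have sE : (s - s^-1) ^+ 2 =
    ((a ^+ 2 + c ^+ 2) * (b ^+ 2 + d ^+ 2)) * (E - E^-1) ^+ 2.
  rewrite -!expRN !expR_sub_expRN arsinhK !exprMn sqr_aspect; ring.
rewrite [leLHS](_ : _ = g ^+ 2 * ((a * (E * y0) + b * (E^-1 * y1)) ^+ 2 +
  (c * (E * y0) + d * (E^-1 * y1)) ^+ 2)); last by ring.
rewrite exprMn -mulrA ler_pM2l ?exprn_gt0 ?expR_gt0 //.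
exact: diagonal_flow_norm.
Qed.

(** The rotation part of the second mode is skew-symmetric, so it cancels in
    the derivative of the squared norm, which is [2 alpha] times itself. *)
Lemma mode2_arc (l r : R) : 0 <= l ->
  (forall t : R, l < t < r -> is_derive t 1 x (A2 *m x t)) ->
  forall t, l <= t <= r -> n t = expR (alpha * (t - l)) * n l.
Proof.
move=> l0 dx t ltr.
pose y i (u : R) : R := (invmx P2 *m x u) i 0.
have dy i (u : R) : l < u < r -> is_derive u 1 (y i)
    ((mx2 alpha beta (- beta) alpha *m (invmx P2 *m x u)) i 0).
  move=> /dx /(is_derive_mulmx_coord (invmx P2) i).
  by rewrite A2E !mulmxA mulVmx // mul1mx.
have cy i : {within `[l, r], continuous (y i)} by exact: cont_coord.
have n2 : n t ^+ 2 = expR (2 * alpha * (t - l)) * n l ^+ 2.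
  rewrite !sqr_enorm.
  apply: (exponential_solution (r := r)
    (f := fun w => y 0 w ^+ 2 + y 1 w ^+ 2)) => //.
    by move=> u; apply: cvgD; apply: cvgM; exact: cy.
  move=> u lur.
  have d0 : is_derive u 1 (y 0) (alpha * y 0 u + beta * y 1 u).
    by have := dy 0 u lur; rewrite (mulmx_mx2 _ _ _ _ _).1.
  have d1 : is_derive u 1 (y 1) (- beta * y 0 u + alpha * y 1 u).
    by have := dy 1 u lur; rewrite (mulmx_mx2 _ _ _ _ _).2.
  apply: (is_derive_eq (is_deriveD (is_deriveM d0 d0) (is_deriveM d1 d1))).
  by rewrite /GRing.scale /=; ring.
apply/eqP; rewrite -(@eqrXn2 _ 2) ?mulr_ge0 ?expR_ge0 ?enorm_ge0 //.
by rewrite n2 exprMn -expRM_natl -[2 * alpha * _]mulrA.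
Qed.

End Arcs.

Section Cycles.
Variables (eta tau : R) (s : signal R).
Hypotheses (eta0 : 0 < eta) (tau0 : 0 < tau) (tauE : alpha * eta = phi tau).
Hypothesis sS : signals tau eta s.

Let C : R := m * expR (alpha * eta).

Let phi_tau_gt0 : 0 < phi tau.
Proof. by rewrite -tauE mulr_gt0. Qed.

Let phi_le (t t' : R) : tau <= t -> t <= t' -> phi t <= phi t'.
Proof.
move=> tt tt'.
have phit : 0 <= phi t.
  apply: (le_trans (ltW phi_tau_gt0)); apply: decay_le (ltW _) tt => //.
  exact: aspect_ge1.
by apply: decay_le tt' => //; [exact: aspect_ge1|exact: lt_le_trans tt].
Qed.

Lemma overshoot_gt0 : 0 < C.
Proof. by rewrite mulr_gt0 ?expR_gt0 // (lt_le_trans _ aspect_ge1). Qed.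

Lemma cycle_exponent_le0 k : alpha * dwell2 s k - phi (dwell1 s k) <= 0.
Proof.
have [_ /(_ k)[t1 s1]] := sS; rewrite subr_le0.
apply: (le_trans _ (phi_le (lexx _) t1)).
by rewrite -tauE ler_pM2l.
Qed.

(** As [t_k >= tau] and [s_k <= eta], a deviation is a strict gain: either the
    stable mode lasts longer by [e] or the unstable one is shorter by [e]. *)
Lemma deviant_cycle_exponent (e : R) k : 0 < e ->
  e <= `|tau - dwell1 s k| \/ e <= `|eta - dwell2 s k| ->
  alpha * dwell2 s k - phi (dwell1 s k) <=
  Num.max (phi tau - phi (tau + e)) (- (alpha * e)).
Proof.
have [_ /(_ k)[t1 s1]] := sS; move=> e0 dev; rewrite le_max; apply/orP.
case: dev => dev; [left|right].
  rewrite -tauE lerB ?ler_pM2l // phi_le ?lerDl ?(ltW e0) //.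
  by move: dev; rewrite distrC ger0_norm ?subr_ge0 // lerBrDl.
have s2 : dwell2 s k <= eta - e.
  by move: dev; rewrite ger0_norm ?subr_ge0 // => ?; lra.
apply: (@le_trans _ _ (alpha * (eta - e) - phi tau)).
  by rewrite lerB ?phi_le // ler_pM2l.
by rewrite mulrBr tauE addrAC subrr add0r.
Qed.

Section Trajectory.
Variable x : R -> 'cV[R]_2.
Hypothesis sx : solution A1 A2 s x.

Let n (t : R) : R := enorm (invmx P2 *m x t).

Let n_ge0 t : 0 <= n t. Proof. exact: enorm_ge0. Qed.

Lemma cycle_mode1 k (t : R) : jump s (2 * k) <= t <= jump s (2 * k + 1) ->
  n t <= expR (- phi (t - jump s (2 * k))) * n (jump s (2 * k)).
Proof.
have [cx dx] := sx.
apply: mode1_arc => //; first exact: jump_ge0.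
move=> u; rewrite addn1 => /[dup] /andP[ku _] /arc_no_jump[su nj].
have [s1 _] := mode_at_jumps k sS.1.
by have := dx u (le_lt_trans (jump_ge0 _ _) ku) nj; rewrite su s1.
Qed.

Lemma cycle_mode2 k (t : R) : jump s (2 * k + 1) <= t <= jump s (2 * k + 2) ->
  n t = expR (alpha * (t - jump s (2 * k + 1))) * n (jump s (2 * k + 1)).
Proof.
have [cx dx] := sx.
apply: mode2_arc => //; first exact: jump_ge0.
move=> u; rewrite [(2 * k + 2)%N]addnS.
move=> /[dup] /andP[ku _] /arc_no_jump[su nj].
have [_ s2] := mode_at_jumps k sS.1.
by have := dx u (le_lt_trans (jump_ge0 _ _) ku) nj; rewrite su s2.
Qed.

Lemma cycle_contraction k :
  n (jump s (2 * k + 2)) <=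
  expR (alpha * dwell2 s k - phi (dwell1 s k)) * n (jump s (2 * k)).
Proof.
rewrite (@cycle_mode2 k); last by rewrite lexx jump_le leq_add2l.
rewrite expRD -mulrA ler_pM2l ?expR_gt0 //.
by apply: cycle_mode1; rewrite lexx jump_le leq_addr.
Qed.

Lemma cycle_nonincreasing k : n (jump s (2 * k + 2)) <= n (jump s (2 * k)).
Proof.
apply: (le_trans (cycle_contraction k)); rewrite ler_piMl ?n_ge0 //.
by rewrite -expR0 ler_expR cycle_exponent_le0.
Qed.

(** [phi] may be negative at short times, so even the first mode may increase
    the norm, but by a factor at most [m], since [phi t >= - ln m]; the second
    mode then contributes at most [exp (alpha eta)]. *)
Lemma cycle_overshoot k (t : R) : jump s (2 * k) <= t <= jump s (2 * k + 2) ->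
  n t <= C * n (jump s (2 * k)).
Proof.
move=> /andP[kt tk].
have m0 : 0 < m by rewrite (lt_le_trans _ aspect_ge1).
have first u : jump s (2 * k) <= u <= jump s (2 * k + 1) ->
    n u <= m * n (jump s (2 * k)).
  move=> /[dup] /andP[ku _] /cycle_mode1 /le_trans; apply.
  rewrite ler_wpM2r ?n_ge0 // -[leRHS]lnK ?posrE // ler_expR lerNl.
  apply: le_trans (decay_ge p q aspect_ge1 _).
  by rewrite lerDr mulr_ge0 ?subr_ge0 // ltW.
have ae1 : 1 <= expR (alpha * eta) by rewrite -expR0 ler_expR mulr_ge0 // ltW.
have [t1|/ltW t1] := leP t (jump s (2 * k + 1)).
  rewrite /C mulrAC; apply: (le_trans (first t _)); first by rewrite kt.
  by rewrite ler_peMr // mulr_ge0 ?n_ge0 // ltW.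
rewrite (@cycle_mode2 k) ?t1 // /C mulrAC [leRHS]mulrC.
apply: ler_pM; rewrite ?expR_ge0 ?n_ge0 //; last first.
  by apply: first; rewrite lexx jump_le leq_addr.
rewrite ler_expR ler_pM2l //; have [_ /(_ k)[_]] := sS.
by apply: le_trans; rewrite lerD2r.
Qed.

Lemma tail_bound K (t : R) :
  jump s (2 * K) <= t -> n t <= C * n (jump s (2 * K)).
Proof.
move=> Kt.
have [k kt] := cycle_of_time s (le_trans (jump_ge0 s _) Kt).
have [Kk|kK] := leqP K k.
  apply: (le_trans (cycle_overshoot kt)); rewrite ler_pM2l ?overshoot_gt0 //.
  rewrite -(subnK Kk); elim: (k - K)%N => // i; apply: le_trans.
  by rewrite addSn mulnS addnC cycle_nonincreasing.
apply: cycle_overshoot; rewrite Kt /=; case/andP: kt => _ /le_trans; apply.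
by rewrite jump_le leq_add2r leq_mul2l ltnW.
Qed.

Lemma tail_small :
  ~ ((dwell1 s k, dwell2 s k) @[k --> \oo] --> (tau, eta)) ->
  forall e : R, 0 < e -> exists K, n (jump s (2 * K)) < e.
Proof.
move=> /deviation_of_not_cvg[e e0 dev].
pose w := Num.max (phi tau - phi (tau + e)) (- (alpha * e)).
have w0 : w < 0.
  rewrite gt_max oppr_lt0 mulr_gt0 // subr_lt0 andbT.
  by apply: decay_lt; rewrite ?aspect_ge1 ?ltrDl.
apply: (@frequent_contraction_small _ (fun k => n (jump s (2 * k))) (expR w)).
- exact: expR_ge0.
- by rewrite -expR0 ltr_expR.
- by [].
- by move=> k; rewrite mulnS addnC cycle_nonincreasing.
move=> N; have [k Nk devk] := dev N; exists k => //.
rewrite mulnS addnC; apply: (le_trans (cycle_contraction k)).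
by rewrite ler_wpM2r // ler_expR deviant_cycle_exponent.
Qed.

End Trajectory.

Lemma signals_stable : stable A1 A2 s.
Proof.
have [K1 K10 HK1] := enorm_mulmx_le (invmx P2).
have [K2 K20 HK2] := enorm_mulmx_le P2.
have L0 : 0 < K2 * (C * K1).
  by rewrite pmulr_rgt0 // pmulr_rgt0 // overshoot_gt0.
move=> e e0; exists (e / (K2 * (C * K1))); first by rewrite divr_gt0.
move=> x sx; rewrite ltr_pdivlMr // mulrC => small t t0.
apply: le_lt_trans small; rewrite -[x t](mulKVmx P2u) -mulrA -[C * K1 * _]mulrA.
apply: (le_trans (HK2 _)); rewrite ler_pM2l //.
have := @tail_bound x sx 0 t; rewrite muln0 jump0 => /(_ (ltW t0)) /le_trans.
by apply; rewrite ler_pM2l ?overshoot_gt0.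
Qed.

Lemma signals_attractive :
  ~ ((dwell1 s k, dwell2 s k) @[k --> \oo] --> (tau, eta)) ->
  forall x, solution A1 A2 s x -> enorm (x t) @[t --> +oo] --> (0 : R).
Proof.
move=> ncv x sx; have [K2 K20 HK2] := enorm_mulmx_le P2.
have L0 : 0 < K2 * C by rewrite pmulr_rgt0 // overshoot_gt0.
apply/cvgrPdist_lt => e e0.
have [|K small] := tail_small sx ncv (e := e / (K2 * C)).
  by rewrite divr_gt0.
exists (jump s (2 * K)); split; first exact: num_real.
move=> t /ltW Kt; rewrite /= sub0r normrN ger0_norm ?enorm_ge0 //.
move: small; rewrite ltr_pdivlMr // mulrC => /(le_lt_trans _); apply.
rewrite -[x t](mulKVmx P2u) -mulrA; apply: (le_trans (HK2 _)).
by rewrite ler_pM2l // tail_bound.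
Qed.

End Cycles.
End SwitchedFlow.

(** * Stability of the switched system *)

Theorem theorem5p3 (R : realType) (A1 A2 P1 P2 : 'M[R]_2)
  (p1 q1 alpha2 beta2 a b c d eta : R)
  (hp1 : 0 < p1) (hpq : p1 < q1) (halpha : 0 < alpha2) (hbeta : beta2 <> 0)
  (hP1 : P1 \in unitmx) (hP2 : P2 \in unitmx)
  (hA1 : A1 = P1 *m mx2 (- p1) 0 0 (- q1) *m invmx P1)
  (hA2 : A2 = P2 *m mx2 alpha2 beta2 (- beta2) alpha2 *m invmx P2)
  (hM : invmx P2 *m P1 = mx2 a b c d)
  (hdet : \det (invmx P2 *m P1) = 1)
  (heta : 0 < eta) :
  exists tau : R,
    unique (is_tau21 p1 q1 alpha2 a b c d eta) tau /\
    (forall s : signal R, signals tau eta s -> stable A1 A2 s) /\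
    (forall s : signal R, signals' tau eta s -> asymptotically_stable A1 A2 s).
Proof.
have det : a * d - b * c = 1 by rewrite -hdet hM det_mx2.
have [tau tauU] := decay_unique_level (aspect_ge1 det) hp1 hpq
  (mulr_gt0 halpha heta).
have [[tau0 tauE] _] := tauU.
have st s : signals tau eta s -> stable A1 A2 s.
  exact: (signals_stable hp1 hpq halpha hP1 hP2 hA1 hA2 hM det heta tau0 tauE).
exists tau; split; [exact: tauU|split] => // s [sS ncv]; split; first exact: st.
exact: (signals_attractive hp1 hpq halpha hP1 hP2 hA1 hA2 hM det heta tau0 tauE
  sS ncv).
Qed.
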